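(* For any $f\in L^1_m(G)$ and any $t\ge0$, $$\|S_tf\|_{L^1}\le\Theta(t)\,\|f\|_m,$$ with either of the following choices: (i) $m(x,v)=e^{\sigma(x,v)}$ on $\bar D\times\mathbb{R}^n$ and $\Theta(t)=e^{-t}$; (ii) $m(x,v)=(1+\sigma(x,v))^\nu$ on $\bar D\times\mathbb{R}^n$ and $\Theta(t)=\frac{1}{(t+1)^\nu}$, where $\nu>1$.
   Context: Let $n \in \{2,3\}$ and let $D \subset \mathbb{R}^n$ be a bounded $C^2$ domain (open, connected) with closure $\bar D$ and boundary $\partial D$; $n_x$ is the unit inward normal at $x\in\partial D$, and $x \mapsto n_x$ is assumed to extend to $\bar D$ as a $W^{1,\infty}$ map. Put $G = D\times\mathbb{R}^n$, $\partial_{+} G=\{(x,v)\in\partial D\times\mathbb{R}^n: v\cdot n_x<0\}$, $\partial_- G=\{(x,v)\in\partial D\times\mathbb{R}^n: v\cdot n_x>0\}$, $\partial_0 G=\{(x,v)\in\partial D\times\mathbb{R}^n: v\cdot n_x=0\}$. Define $\sigma(x,v)=\inf\{t>0:x+tv\in\partial D\}$ for $(x,v)\in G\cup\partial_-G$ and $\sigma(x,v)=0$ for $(x,v)\in\partial_+G\cup\partial_0G$. Here $(S_t)_{t\ge0}$ is the semigroup of linear operators on $L^1(G)$ associated with the free-transport equation with absorbing boundary condition $$\partial_tf+v\cdot\nabla_xf=0\ \text{ in }(0,\infty)\times G,\qquad \gamma_-f=0\ \text{ on }(0,\infty)\times\partial_-G,\qquad f|_{t=0}=f_0\ \text{ in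 }G,$$ where $\gamma_-f$ is the trace of $f$ on $(0,\infty)\times\partial_-G$. Explicitly, for $f_0\in L^1(G)$, $t\ge0$ and almost all $(x,v)\in G$, $S_tf_0(x,v)=f_0(x-tv,v)\,\mathbf{1}_{\{t<\sigma(x,-v)\}}$. For a non-negative measurable weight $w$ on $G$, $L^1_w(G)=\{f\in L^1(G):\|fw\|_{L^1}<\infty\}$ with norm $\|f\|_w=\|fw\|_{L^1}$. *)

(* Defs.v *)
From HB Require Import structures.
From mathcomp Require Import all_boot all_order all_algebra.
From mathcomp Require Import all_classical all_reals all_analysis.

Set Implicit Arguments.
Unset Strict Implicit.
Unset Printing Implicit Defensive.
Import Order.TTheory GRing.Theory Num.Theory.
Import numFieldNormedType.Exports.

Local Open Scope classical_set_scope.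
Local Open Scope ring_scope.

(* R^n is 'rV[R]_n; its library norm is the max norm, so the Euclidean structure is written explicitly where it matters. *)

(* The sigma-algebra generated by the coordinates, as the library does for
   n-tuples; on R^n this is the Borel sigma-algebra. *)
Section measurable_rV.
Variables (R : realType) (n : nat).

Let coors : 'I_n -> 'rV[R]_n -> R := fun i x => x ord0 i.

Let rV_set0 : g_sigma_preimage coors set0.
Proof. exact: sigma_algebra0. Qed.

Let rV_setC A : g_sigma_preimage coors A -> g_sigma_preimage coors (~` A).
Proof. exact: sigma_algebraC. Qed.

Let rV_bigcup (F : (set 'rV[R]_n)^nat) :
  (forall i, g_sigma_preimage coors (F i)) ->
  g_sigma_preimage coors (\bigcup_i (F i)).
Proof. exact: sigma_algebra_bigcup. Qed.

HB.instance Definition _ :=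
  @isMeasurable.Build (measure_tuple_display (R.-ocitv)%mdisp)
    'rV[R]_n (g_sigma_preimage coors) rV_set0 rV_setC rV_bigcup.

End measurable_rV.

Lemma measurable_coord_rV (R : realType) n (i : 'I_n) :
  measurable_fun [set: 'rV[R]_n] (fun x : 'rV[R]_n => x ord0 i).
Proof.
move=> _ Y mY; rewrite setTI; apply: sub_sigma_algebra => /=.
rewrite -bigcup_seq/=; exists i => /=; first by rewrite mem_index_enum.
by exists Y => //; rewrite setTI.
Qed.

Lemma measurable_fun_rV d (T : measurableType d) (R : realType) n
    (f : T -> 'rV[R]_n) :
  (forall i, measurable_fun [set: T] (fun t => f t ord0 i)) ->
  measurable_fun [set: T] f.
Proof.
move=> mf.
suff H : g_sigma_preimage (fun i t => f t ord0 i) `<=` @measurable d T.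
  move=> _ A mA; apply: H.
  rewrite (@g_sigma_preimage_comp _ R n _
    (fun i (x : 'rV[R]_n) => x ord0 i) _ f).
  by exists A.
apply: smallest_sub; first exact: sigma_algebra_measurable.
rewrite -bigcup_seq; apply: bigcup_sub => i _.
by move=> A [B mB <-]; exact: mf.
Qed.

Definition rV_cons (R : realType) n (p : R * 'rV[R]_n) : 'rV[R]_n.+1 :=
  \row_i oapp (p.2 ord0) p.1 (unlift ord0 i).

Lemma measurable_rV_cons (R : realType) n :
  measurable_fun [set: R * 'rV[R]_n] (@rV_cons R n).
Proof.
apply: measurable_fun_rV => i; case: (unliftP ord0 i) => [j|] ->.
- rewrite [X in measurable_fun _ X](_ : _ = (fun x : 'rV[R]_n => x ord0 j) \o snd).
    by apply: measurableT_comp; [exact: measurable_coord_rV|].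
  by apply/funext => p /=; rewrite mxE liftK.
- rewrite [X in measurable_fun _ X](_ : _ = fst) //.
  by apply/funext => p /=; rewrite mxE unlift_none.
Qed.

Section lebesgue_step.
Context {R : realType} {n : nat}.
Variable mu : {sigma_finite_measure set 'rV[R]_n -> \bar R}.

Definition lebesgue_step : set 'rV[R]_n.+1 -> \bar R :=
  pushforward (@lebesgue_measure R \x mu)%E (@rV_cons R n).

Let lebesgue_step0 : lebesgue_step set0 = 0%E.
Proof. by rewrite /lebesgue_step /pushforward preimage_set0 measure0. Qed.

Let lebesgue_step_ge0 A : (0 <= lebesgue_step A)%E.
Proof. by rewrite /lebesgue_step /pushforward measure_ge0. Qed.

Let lebesgue_step_sigma_additive : semi_sigma_additive lebesgue_step.
Proof.
move=> F mF tF mUF; rewrite /lebesgue_step /pushforward preimage_bigcup.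
have mc := @measurable_rV_cons R n.
apply: measure_semi_sigma_additive.
- by move=> k; rewrite -[X in measurable X]setTI; exact: mc.
- apply/trivIsetP => /= i j _ _ ij; rewrite -preimage_setI.
  by move/trivIsetP : tF => /(_ _ _ _ _ ij) ->//; rewrite preimage_set0.
- by rewrite -preimage_bigcup -[X in measurable X]setTI; exact: mc.
Qed.

HB.instance Definition _ := isMeasure.Build _ _ _ lebesgue_step
  lebesgue_step0 lebesgue_step_ge0 lebesgue_step_sigma_additive.

Let lebesgue_step_sigma_finite : sigma_finite setT lebesgue_step.
Proof.
have /sigma_finiteP[F [TF ndF Foo]] := sigma_finiteT (@lebesgue_measure R).
have /sigma_finiteP[H [TH ndH Hoo]] := sigma_finiteT mu.
pose uncons (x : 'rV[R]_n.+1) : R * 'rV[R]_n :=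
  (x ord0 ord0, \row_j x ord0 (lift ord0 j)).
have muncons : measurable_fun setT uncons.
  apply/measurable_fun_pairP; split => /=; first exact: measurable_coord_rV.
  apply: measurable_fun_rV => i.
  rewrite [X in measurable_fun _ X](_ : _ =
    fun x : 'rV[R]_n.+1 => x ord0 (lift ord0 i)); first exact: measurable_coord_rV.
  by apply/funext => x /=; rewrite mxE.
have consK : cancel (@rV_cons R n) uncons.
  move=> [a y]; rewrite /uncons /rV_cons mxE unlift_none /=; congr pair.
  by apply/rowP => j; rewrite !mxE liftK.
exists (fun k => uncons @^-1` (F k `*` H k)) => [|k].
  apply/esym; rewrite -preimage_bigcup; apply/seteqP; split => // x _ /=.
  have [i _ Fi] : (\bigcup_i F i) (uncons x).1 by rewrite -TF.
  have [j _ Hj] : (\bigcup_i H i) (uncons x).2 by rewrite -TH.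
  exists (maxn i j) => //; split.
  - by move: (uncons x).1 Fi; exact/subsetPset/ndF/leq_maxl.
  - by move: (uncons x).2 Hj; exact/subsetPset/ndH/leq_maxr.
have [mF Fk] := Foo k; have [mH Hk] := Hoo k; split.
  by rewrite -[X in measurable X]setTI; apply: muncons => //; exact: measurableX.
rewrite /lebesgue_step /pushforward.
rewrite [X in (_ X < _)%E](_ : _ = F k `*` H k); last first.
  by apply/funext => p; rewrite /preimage /mkset consK.
by rewrite product_measure1E// lte_mul_pinfty// ge0_fin_numE.
Qed.

HB.instance Definition _ := @Measure_isSigmaFinite.Build _ _ _
  lebesgue_step lebesgue_step_sigma_finite.

End lebesgue_step.

Fixpoint lebesgue_rV (R : realType) n :
    {sigma_finite_measure set 'rV[R]_n -> \bar R} :=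
  match n with
  | 0 => \d_(0 : 'rV[R]_0)
  | n.+1 => lebesgue_step (lebesgue_rV R n)
  end.

Lemma lebesgue_rV_box (R : realType) n (A : 'I_n -> set R) :
  (forall i, measurable (A i)) ->
  lebesgue_rV R n [set x | forall i, A i (x ord0 i)] =
  (\big[*%E/1]_(i < n) @lebesgue_measure R (A i))%E.
Proof.
elim: n A => [|n IHn] A mA.
  by rewrite big_ord0 /= diracE mem_set// => -[].
rewrite big_ord_recl -IHn => [|i]; last exact: mA.
rewrite /= /lebesgue_step /pushforward.
rewrite [X in (_ X = _)%E](_ : _ =
  A ord0 `*` [set x : 'rV[R]_n | forall i, A (lift ord0 i) (x ord0 i)]).
  rewrite product_measure1E//; first exact: mA.
  rewrite [X in measurable X](_ : _ = \bigcap_(i in [set: 'I_n])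
    ((fun x : 'rV[R]_n => x ord0 i) @^-1` A (lift ord0 i))).
    apply: fin_bigcap_measurable => // i _.
    by rewrite -[X in measurable X]setTI; exact: measurable_coord_rV.
  by apply/seteqP; split => x H i; [move=> _; exact: H|exact: (H i)].
apply/seteqP; split => -[a y].
  move=> H; split => /= [|i].
    by have := H ord0; rewrite mxE unlift_none.
  by have := H (lift ord0 i); rewrite mxE liftK.
by move=> [/= Ha Hy] i; rewrite mxE; case: (unliftP ord0 i) => [j|] ->.
Qed.

Section geometry.
Context {R : realType} {n : nat}.
Implicit Types (D U : set 'rV[R]_n) (f g phi psi : 'rV[R]_n -> R).

Definition dot (u v : 'rV[R]_n) : R := \sum_(i < n) u ord0 i * v ord0 i.

Definition euclidean_norm (u : 'rV[R]_n) : R := Num.sqrt (dot u u).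

Definition boundary D : set 'rV[R]_n := closure D `\` interior D.

Definition partial (i : 'I_n) f : 'rV[R]_n -> R :=
  'D_(delta_mx ord0 i) f.

Definition gradient f (x : 'rV[R]_n) : 'rV[R]_n := \row_i partial i f x.

(* [Ck_on k U f]: f is of class C^k on the open set U. *)
Fixpoint Ck_on (k : nat) U f : Prop :=
  (forall x, U x -> {for x, continuous f}) /\
  match k with
  | 0 => True
  | k'.+1 => forall i : 'I_n,
      (forall x, U x -> derivable f x (delta_mx ord0 i)) /\
      Ck_on k' U (partial i f)
  end.

(* D is locally the superlevel set {phi > 0} of a C^2 function without
   critical points. *)
Definition C2_defining_function D (x : 'rV[R]_n) U phi : Prop :=
  [/\ open U, U x, Ck_on 2 U phi,
      (forall y, U y -> gradient phi y != 0) &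
      (forall y, U y -> (D y <-> 0 < phi y))].

Definition C2_boundary D : Prop :=
  forall x, boundary D x -> exists U phi, C2_defining_function D x U phi.

(* The normal does not depend on the defining function; as phi > 0 inside D,
   its gradient points inward. *)
Definition inward_unit_normal D (x nx : 'rV[R]_n) : Prop :=
  exists U phi, C2_defining_function D x U phi /\
    nx = (euclidean_norm (gradient phi x))^-1 *: gradient phi x.

Definition Linfty D f : Prop :=
  measurable_fun D f /\
  exists M : R, {ae lebesgue_rV R n, forall x, D x -> `|f x| <= M}.

Definition test_function D psi : Prop :=
  (forall k, Ck_on k setT psi) /\
  exists K, [/\ compact K, K `<=` D & forall x, ~ K x -> psi x = 0].

Definition weak_partial D (i : 'I_n) f g : Prop :=
  forall psi, test_function D psi ->
    \int[lebesgue_rV R n]_(x in D) (f x * partial i psi x) =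
    - \int[lebesgue_rV R n]_(x in D) (g x * psi x).

Definition W1infty D f : Prop :=
  Linfty D f /\ forall i, exists g, Linfty D g /\ weak_partial D i f g.

(* Elements of W^{1,infty}(D) are taken with their continuous representative:
   this is what gives a meaning to their values on the boundary. *)
Definition W1infty_extension D (nx N : 'rV[R]_n -> 'rV[R]_n) : Prop :=
  [/\ {within closure D, continuous N},
      (forall j, W1infty D (fun x => N x ord0 j)) &
      (forall x, boundary D x -> N x = nx x)].

End geometry.

Section transport.
Context {R : realType} {n : nat}.
Local Notation E := 'rV[R]_n.
Variables (D : set E) (nx : E -> E).
Implicit Types (f : E * E -> R) (w : E * E -> \bar R).

Definition phase : set (E * E) := D `*` setT.

Definition phase_plus : set (E * E) :=
  [set z | boundary D z.1 /\ dot z.2 (nx z.1) < 0].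

Definition phase_minus : set (E * E) :=
  [set z | boundary D z.1 /\ dot z.2 (nx z.1) > 0].

Definition phase_zero : set (E * E) :=
  [set z | boundary D z.1 /\ dot z.2 (nx z.1) = 0].

(* Extended real valued, so that the infimum of the empty set (for instance
   when v = 0) is +oo.  The value 0 is the prescribed one on
   phase_plus `|` phase_zero; elsewhere (x outside the closure of D) it is a
   dummy. *)
Definition sigma (x v : E) : \bar R :=
  if (x, v) \in phase `|` phase_minus then
    ereal_inf [set t%:E | t in [set t : R | 0 < t /\ boundary D (x + t *: v)]]
  else 0%E.

Definition lebesgue_phase : set (E * E) -> \bar R :=
  (lebesgue_rV R n \x lebesgue_rV R n)%E.

HB.instance Definition _ := Measure.on lebesgue_phase.

(* Functions on G are represented by functions on R^n x R^n whose values
   outside G are irrelevant. *)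
Definition L1 f : Prop := lebesgue_phase.-integrable phase (EFin \o f).

Definition L1norm f : \bar R :=
  (\int[lebesgue_phase]_(z in phase) `|f z|%:E)%E.

Definition wL1norm w f : \bar R :=
  (\int[lebesgue_phase]_(z in phase) (`|f z|%:E * w z))%E.

Definition wL1 w f : Prop := L1 f /\ (wL1norm w f < +oo)%E.

(* The free-transport semigroup with absorbing boundary condition. *)
Definition transport (t : R) f : E * E -> R := fun z =>
  if (t%:E < sigma z.1 (- z.2))%E then f (z.1 - t *: z.2, z.2) else 0.

Definition exp_weight : E * E -> \bar R := fun z => expeR (sigma z.1 z.2).

Definition pow_weight (nu : R) : E * E -> \bar R :=
  fun z => ((1 + sigma z.1 z.2) `^ nu)%E.

End transport.

(* Main.v *)
Require Import Defs.
From HB Require Import structures.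
From mathcomp Require Import all_boot all_order all_algebra.
From mathcomp Require Import all_classical all_reals all_analysis.
From mathcomp Require Import measurable_realfun.
Set Implicit Arguments.
Unset Strict Implicit.
Unset Printing Implicit Defensive.
Import Order.TTheory GRing.Theory Num.Theory.
Import numFieldNormedType.Exports.
Local Open Scope classical_set_scope.
Local Open Scope ring_scope.

(** Suppose that the transported density does not vanish at (x, v): the ray going backward from x along v stays in D up to time t.
    Its end point y = x - t v then lies in D, and the forward ray from y runs
    through the same segment, so it cannot reach the boundary before time t:
    the exit time sigma (y, v) is at least t.  As both weights are
    nondecreasing functions of sigma, the weight at (y, v) is at least
    1 / Theta(t), whence
      |S_t f| (y + t v, v) <= Theta(t) * (|f| m) (y, v)   for all (y, v) in G
    ([backward_flow_exit_time] carries the geometry).  The shear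
    (y, v) |-> (y + t v, v) preserves the Lebesgue measure of phase space
    ([lebesgue_phase_flow]), because it acts by a translation at each fixed v,
    and integrating the pointwise bound gives the theorem
    ([L1norm_transport_le]).

    The integral of a nonnegative function is the supremum of the integrals of
    the simple functions below it, so a pointwise bound along a
    measure-preserving map passes to the integrals of arbitrary nonnegative
    functions ([ge0_le_integral_preserving]); this spares a proof that the exit
    time, hence the weight, is measurable. *)

(** * Measure-preserving maps *)

Section measure_preserving_maps.
Local Open Scope ereal_scope.
Context d1 d2 (T1 : measurableType d1) (T2 : measurableType d2)
        (R : realType).

Import HBNNSimple.

(** Pulling back along S a simple function that lies below F, and dividing it
    by c, yields a simple function below G whose integral is smaller by the
    factor c. *)
Lemma ge0_le_integral_preserving (mu : {measure set T1 -> \bar R})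
    (S : T1 -> T1) (c : R) (F G : T1 -> \bar R) :
  measurable_fun setT S ->
  (forall A, measurable A -> mu (S @^-1` A) = mu A) ->
  (0 < c)%R -> (forall x, 0 <= F x) -> (forall x, 0 <= G x) ->
  (forall x, F (S x) <= c%:E * G x) ->
  \int[mu]_x F x <= c%:E * \int[mu]_x G x.
Proof.
move=> mS muS c0 F0 G0 FG.
rewrite [leLHS]ge0_integralTE//; apply: ge_ereal_sup => _ [h hF <-].
have <- : \int[mu]_x (h x)%:E = sintegral mu h.
  by rewrite integral_nnsfun// patch_setT.
have hS : \int[mu]_x (h x)%:E = \int[mu]_x (h (S x))%:E.
  rewrite -(@ge0_integral_pushforward _ _ _ _ R S mS mu setT (EFin \o h))//.
  - by apply: eq_measure_integral => A mA _; rewrite /= /pushforward muS.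
  - by apply/measurable_EFinP/measurable_funP.
  - by move=> x _; rewrite lee_fin.
have mhS : measurable_fun setT (h \o S).
  by apply: measurableT_comp => //; exact: measurable_funP.
(* The factor c crosses the integral on the left only, where the integrand is
   a simple function: G is not known to be measurable. *)
rewrite hS -[leLHS]mul1e -(@divff _ c) ?gt_eqF// EFinM -muleA.
rewrite lee_pmul2l ?lte_fin//.
rewrite -ge0_integralZl//; last 3 first.
- exact/measurable_EFinP.
- by move=> x _; rewrite lee_fin.
- by rewrite lee_fin invr_ge0 ltW.
pose k x := (c^-1 * h (S x))%R.
have mk : measurable_fun setT k by exact: measurable_funM.
have k0 x : (0 <= k x)%R by rewrite mulr_ge0 // invr_ge0 ltW.
have kfin : finite_set (range k).
  apply: (@sub_finite_set _ _ ((fun y => c^-1 * y)%R @` range h)).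
    by move=> _ [x _ <-]; exists (h (S x)) => //; exists (S x).
  by apply: finite_image; exact: fimfunP.
pose k1 := isMeasurableFun.Build _ _ _ _ k mk.
pose k2 := FiniteImage.Build _ _ k kfin.
pose k3 := isNonNegFun.Build _ _ k k0.
pose K : {nnsfun T1 >-> R} := HB.pack k k1 k2 k3.
have -> : \int[mu]_x ((c^-1)%:E * (h (S x))%:E) = sintegral mu K.
  transitivity (\int[mu]_x (K x)%:E).
    by apply: eq_integral.
  by rewrite integral_nnsfun// patch_setT.
rewrite [leRHS]ge0_integralTE//; apply: ereal_sup_ubound; exists K => // x.
rewrite /= /k -(@lee_pmul2l _ c%:E)// ?lte_fin//.
rewrite -EFinM mulVKf ?gt_eqF//.
exact: le_trans (hF _) (FG _).
Qed.

(** The pushforward of m1 \x m2 agrees with it on rectangles. *)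
Lemma product_measure_map_preserving
    (m1 : {sigma_finite_measure set T1 -> \bar R})
    (m2 : {sigma_finite_measure set T2 -> \bar R})
    (f1 : T1 -> T1) (f2 : T2 -> T2) :
  measurable_fun setT f1 -> measurable_fun setT f2 ->
  (forall A, measurable A -> m1 (f1 @^-1` A) = m1 A) ->
  (forall A, measurable A -> m2 (f2 @^-1` A) = m2 A) ->
  forall A, measurable A ->
    (m1 \x m2) ((fun z => (f1 z.1, f2 z.2)) @^-1` A) = (m1 \x m2) A.
Proof.
move=> mf1 mf2 m1f m2f A mA.
set f := (X in X @^-1` _).
have mf : measurable_fun setT f.
  apply/measurable_fun_pairP; split.
    exact: (measurableT_comp mf1 measurable_fst).
  exact: (measurableT_comp mf2 measurable_snd).
pose phi_mixin := isMeasurableFun.Build _ _ _ _ _ mf.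
pose phi : {mfun _ >-> _} := HB.pack f phi_mixin.
transitivity (pushforward (m1 \x m2) phi A) => //.
apply/esym/product_measure_unique => //.
move=> B C mB mC.
transitivity ((m1 \x m2) ((f1 @^-1` B) `*` (f2 @^-1` C))) => //.
rewrite product_measure1E//; last 2 first.
  by rewrite -[X in measurable X]setTI; exact: mf1.
  by rewrite -[X in measurable X]setTI; exact: mf2.
by congr (_ * _); [exact: m1f|exact: m2f].
Qed.

(** Unlike a product of maps, a shear does not send rectangles to rectangles,
    so the sections at fixed y are compared instead; this is where the product
    measure has to be computed by integrating over the second variable. *)
Lemma product_measure_shear_preserving
    (m1 : {sigma_finite_measure set T1 -> \bar R})
    (m2 : {sigma_finite_measure set T2 -> \bar R}) (phi : T2 -> T1 -> T1) :
  measurable_fun setT (fun z : T1 * T2 => phi z.2 z.1) ->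
  (forall y A, measurable A -> m1 (phi y @^-1` A) = m1 A) ->
  forall A, measurable A ->
    (m1 \x m2) ((fun z => (phi z.2 z.1, z.2)) @^-1` A) = (m1 \x m2) A.
Proof.
move=> mphi m1phi A mA.
set S := (X in X @^-1` _).
have mS : measurable_fun setT S.
  by apply/measurable_fun_pairP; split => //; exact: measurable_snd.
have mSA : measurable (S @^-1` A).
  by rewrite -[X in measurable X]setTI; exact: mS.
have fub B : measurable B -> (m1 \x m2) B = (m1 \x^ m2) B.
  by apply: product_measure_unique => // *; exact: product_measure2E.
rewrite !fub// /product_measure2; apply: eq_integral => y _ /=.
rewrite -[in RHS](m1phi y); last exact: measurable_ysection.
by congr (m1 _); apply/seteqP; split => x; rewrite /ysection /= !inE.
Qed.

End measure_preserving_maps.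

(** * Translation invariance of the Lebesgue measure *)

Section translation_invariance.
Context {R : realType}.

Lemma lebesgue_measure_translation (a : R) (A : set R) : measurable A ->
  lebesgue_measure ((fun x => x + a) @^-1` A) = lebesgue_measure A.
Proof.
move=> mA.
pose f : measurableTypeR R -> measurableTypeR R := fun x => x + a.
have mf : measurable_fun setT f by exact: measurable_funD.
pose phi_mixin := isMeasurableFun.Build _ _ _ _ _ mf.
pose phi : {mfun measurableTypeR R >-> measurableTypeR R} :=
  HB.pack f phi_mixin.
apply/esym.
apply: (lebesgue_measure_unique
  (mu := pushforward (@lebesgue_measure R) phi)) => //=.
move=> _ [[b c]] _ <-; rewrite /pushforward.
rewrite [X in _ = _ X](_ : _ = `](b - a), (c - a)]%classic); last first.
  by apply/seteqP; split => x /=; rewrite !in_itv/= ltrBlDr lerBrDr.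
rewrite !lebesgue_measure_itv/= !lte_fin ltrD2r.
by case: ifP => // _; rewrite -!EFinB opprB addrA subrK.
Qed.

Lemma measurable_translation n (a : 'rV[R]_n) :
  measurable_fun setT (fun x : 'rV[R]_n => x + a).
Proof.
apply: measurable_fun_rV => i.
rewrite [X in measurable_fun _ X](_ : _ =
    (fun x : 'rV[R]_n => x ord0 i + a ord0 i)); last first.
  by apply/funext => x; rewrite mxE.
by apply: measurable_funD => //; exact: measurable_coord_rV.
Qed.

(** In dimension n + 1 a translation is, through [rV_cons], the product of a
    translation of the line and of a translation in dimension n. *)
Lemma lebesgue_rV_translation n (a : 'rV[R]_n) (A : set 'rV[R]_n) :
  measurable A ->
  lebesgue_rV R n ((fun x => x + a) @^-1` A) = lebesgue_rV R n A.
Proof.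
elim: n a A => [|n IHn] a A mA.
  have x0 (x : 'rV[R]_0) : x + a = x by apply/rowP => -[].
  by congr (lebesgue_rV R 0 _); apply/seteqP; split => x /=; rewrite x0.
rewrite /= /lebesgue_step /pushforward.
pose a' : 'rV[R]_n := \row_j a ord0 (lift ord0 j).
have consD (p : R * 'rV[R]_n) :
    rV_cons (p.1 + a ord0 ord0, p.2 + a') = rV_cons p + a.
  by apply/rowP => i; rewrite !mxE; case: (unliftP ord0 i) => [j|] -> /=;
    rewrite ?mxE.
have mA' : measurable (@rV_cons R n @^-1` A).
  by rewrite -[X in measurable X]setTI; exact: measurable_rV_cons.
rewrite -[RHS](@product_measure_map_preserving _ _ _ _ R (@lebesgue_measure R)
   (lebesgue_rV R n) (fun x => x + a ord0 ord0) (fun x => x + a')) //.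
- by congr (_ _); apply/seteqP; split => p; rewrite /preimage /= consD.
- exact: measurable_funD.
- exact: measurable_translation.
- by move=> B mB; exact: lebesgue_measure_translation.
- by move=> B mB; exact: IHn.
Qed.

Lemma measurable_flow n (t : R) :
  measurable_fun setT
    (fun z : 'rV[R]_n * 'rV[R]_n => z.1 + t *: z.2).
Proof.
apply: measurable_fun_rV => i.
rewrite [X in measurable_fun _ X](_ : _ =
  (fun z : 'rV[R]_n * 'rV[R]_n => z.1 ord0 i + t * z.2 ord0 i)); last first.
  by apply/funext => x; rewrite !mxE.
apply: measurable_funD; last apply: measurable_funM => //.
- exact: (measurableT_comp (measurable_coord_rV i) measurable_fst).
- exact: (measurableT_comp (measurable_coord_rV i) measurable_snd).
Qed.

(** At a fixed velocity the free flow is a translation in space. *)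
Lemma lebesgue_phase_flow n (t : R) (A : set ('rV[R]_n * 'rV[R]_n)) :
  measurable A ->
  lebesgue_phase ((fun z => (z.1 + t *: z.2, z.2)) @^-1` A) =
  lebesgue_phase A.
Proof.
apply: (@product_measure_shear_preserving _ _ _ _ R (lebesgue_rV R n)
  (lebesgue_rV R n) (fun v x => x + t *: v)).
  exact: measurable_flow.
by move=> v B mB; exact: lebesgue_rV_translation.
Qed.

End translation_invariance.

(** * Exit times and the transport semigroup *)

Section exit_time.
Context {R : realType} {n : nat}.
Context (D : set 'rV[R]_n) (nx : 'rV[R]_n -> 'rV[R]_n) (openD : open D).

Lemma not_boundary_open x : D x -> ~ boundary D x.
Proof. by move=> Dx [_]; rewrite (interior_id D).1. Qed.

(** Since C misses the boundary, C meets D and the closure of D in the same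
    set, which is thus clopen in C. *)
Lemma connected_sub_open (C : set 'rV[R]_n) : connected C ->
  C `&` D !=set0 -> C `&` boundary D = set0 -> C `<=` D.
Proof.
move=> connC CD CbD.
have <- : C `&` D = C; last exact: subIsetr.
apply: connC => //; first by exists D.
exists (closure D); first exact: closed_closure.
apply/seteqP; split => x [Cx Dx]; split => //; first exact: subset_closure.
apply: contrapT => nDx.
suff : (C `&` boundary D) x by rewrite CbD.
by split => //; split => //; rewrite (interior_id D).1.
Qed.

Lemma sigma_le_hitting x v (s : R) : D x -> 0 < s ->
  boundary D (x + s *: v) -> (sigma D nx x v <= s%:E)%E.
Proof.
move=> Dx s0 bs; rewrite /sigma mem_set; last by left.
by apply: ereal_inf_lbound; exists s.
Qed.

Lemma le_sigma x v (t : R) : D x ->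
  (forall s, 0 < s -> boundary D (x + s *: v) -> t <= s) ->
  (t%:E <= sigma D nx x v)%E.
Proof.
move=> Dx H; rewrite /sigma mem_set; last by left.
by apply: le_ereal_inf_tmp => _ [s [s0 bs] <-]; rewrite lee_fin; exact: H.
Qed.

(** The segment is connected and starts in D, so it can leave D only through
    the boundary, which it does not meet before the backward exit time. *)
Lemma backward_segment_sub x v (t : R) : 0 <= t -> D x ->
  (t%:E < sigma D nx x (- v))%E ->
  forall s, 0 <= s <= t -> D (x - s *: v).
Proof.
move=> t0 Dx tsigma.
pose g (s : R) := x - s *: v.
suff : g @` `[0, t] `<=` D.
  by move=> gD s st; apply: gD; exists s => //=; rewrite in_itv.
apply: connected_sub_open.
- apply: connected_continuous_connected; first exact: segment_connected.
  apply: continuous_subspaceT => s.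
  by apply: cvgB; [exact: cvg_cst|exact: scalel_continuous].
- exists x; split => //; exists 0; last by rewrite /g scale0r subr0.
  by rewrite /= in_itv/= lexx.
- rewrite -subset0 => _ [[s + <-] bs]; rewrite /= in_itv/= => /andP[s0 st].
  have [s_eq0|s_neq0] := eqVneq s 0.
    by move: bs; rewrite s_eq0 /g scale0r subr0; exact: not_boundary_open.
  have s_gt0 : 0 < s by rewrite lt_neqAle eq_sym s_neq0.
  have : (sigma D nx x (- v) <= s%:E)%E.
    by apply: (sigma_le_hitting Dx s_gt0); rewrite scalerN.
  by rewrite leNgt (le_lt_trans _ tsigma)// lee_fin.
Qed.

(** The points of the forward ray from x - t v up to time t are those of the
    backward segment from x, which lies in D. *)
Lemma backward_flow_exit_time x v (t : R) : 0 <= t -> D x ->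
  (t%:E < sigma D nx x (- v))%E ->
  D (x - t *: v) /\ (t%:E <= sigma D nx (x - t *: v) v)%E.
Proof.
move=> t0 Dx tsigma.
have seg := backward_segment_sub t0 Dx tsigma.
have Dy : D (x - t *: v) by apply: seg; rewrite t0 lexx.
split; first exact: Dy.
apply: (le_sigma Dy) => s s0.
apply: contraPP => /negP; rewrite -ltNge => st.
have -> : x - t *: v + s *: v = x - (t - s) *: v.
  by rewrite scalerBl opprB addrA addrAC.
apply: not_boundary_open; apply: seg.
by rewrite subr_ge0 ltW//= gerBl ltW.
Qed.

(** The common form of both decay estimates: the weight only matters through
    its lower bound 1 / c on the set of points whose exit time is at least t. *)
Lemma L1norm_transport_le (w : 'rV[R]_n * 'rV[R]_n -> \bar R) (c t : R) f :
  0 <= t -> 0 < c -> (forall z, (0 <= w z)%E) ->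
  (forall z, (t%:E <= sigma D nx z.1 z.2)%E -> (1 <= c%:E * w z)%E) ->
  (L1norm D (transport D nx t f) <= c%:E * wL1norm D w f)%E.
Proof.
move=> t0 c0 w0 cw; rewrite /L1norm /wL1norm.
rewrite [X in (X <= _)%E]integral_mkcond [X in (_ <= _ * X)%E]integral_mkcond.
(* The comparison is made along the forward flow: the value at (y + t v, v)
   of the transported density is f (y, v). *)
apply: (@ge0_le_integral_preserving _ _ R (@lebesgue_phase R n)
  (fun z => (z.1 + t *: z.2, z.2))).
- apply/measurable_fun_pairP; split; last exact: measurable_snd.
  exact: measurable_flow.
- exact: lebesgue_phase_flow.
- exact: c0.
- by move=> z; apply: erestrict_ge0 => {}z _; rewrite lee_fin.
- by move=> z; apply: erestrict_ge0 => {}z _; rewrite mule_ge0 ?lee_fin.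
move=> [y v] /=.
have rhs0 : (0 <= c%:E * ((fun z => `|f z|%:E * w z) \_ (phase D)) (y, v))%E.
  apply: mule_ge0; first by rewrite lee_fin ltW.
  by apply: erestrict_ge0 => z _; rewrite mule_ge0 ?lee_fin.
rewrite {1}/patch; case: ifPn => //; rewrite inE => -[/= Dx _].
rewrite /transport /=; case: ifPn => [tsigma|_]; last by rewrite normr0.
have [] := backward_flow_exit_time t0 Dx tsigma; rewrite addrK => Dy ty.
rewrite patchE mem_set; last by split.
by rewrite muleCA lee_pemulr ?lee_fin// cw.
Qed.

End exit_time.

Theorem theorem5 (R : realType) (n : nat) (D : set 'rV[R]_n)
    (nx : 'rV[R]_n -> 'rV[R]_n)
    (n23 : n = 2%N \/ n = 3%N)
    (openD : open D) (connectedD : connected D) (boundedD : bounded_set D)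
    (C2D : C2_boundary D)
    (nxE : forall x, boundary D x -> inward_unit_normal D x (nx x))
    (nx_ext : exists N, W1infty_extension D nx N) :
  (forall f, wL1 D (exp_weight D nx) f -> forall t : R, 0 <= t ->
     (L1norm D (transport D nx t f) <=
        (expR (- t))%:E * wL1norm D (exp_weight D nx) f)%E) /\
  (forall nu : R, 1 < nu ->
   forall f, wL1 D (pow_weight D nx nu) f -> forall t : R, 0 <= t ->
     (L1norm D (transport D nx t f) <=
        (((t + 1) `^ nu)^-1)%:E * wL1norm D (pow_weight D nx nu) f)%E).
Proof.
split=> [f _ t t0|nu nu1 f _ t t0]; apply: L1norm_transport_le => //.
- exact: expR_gt0.
- by move=> z; exact: expeR_ge0.
- move=> z tz; rewrite -lee_expeR in tz.
  rewrite -[1%E](_ : (expR (- t))%:E * (expR t)%:E = 1)%E.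
    by rewrite lee_pmul2l// lte_fin expR_gt0.
  by rewrite -EFinM -expRD addNr expR0.
- by rewrite invr_gt0 powR_gt0// ltr_wpDl.
- by move=> z; exact: poweR_ge0.
- move=> z tz.
  have t1 : 0 < (t + 1) `^ nu by rewrite powR_gt0// ltr_wpDl.
  rewrite -[1%E](_ : (((t + 1) `^ nu)^-1)%:E * ((t + 1) `^ nu)%:E = 1)%E;
    last by rewrite -EFinM mulVf// gt_eqF.
  rewrite lee_pmul2l// ?lte_fin ?invr_gt0//.
  have t1s : ((t + 1)%:E <= 1 + sigma D nx z.1 z.2)%E.
    by rewrite EFinD addeC leeD2l.
  rewrite -poweR_EFin; apply: gt0_ler_poweR => //.
  + by rewrite (le_trans _ (ltW nu1)).
  + by rewrite in_itv/= leey lee_fin addr_ge0.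
  + by rewrite in_itv/= leey andbT (le_trans _ t1s)// lee_fin addr_ge0.
Qed.
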